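(* Let $f_x$ and $\sigma_x>0$ ($x\in\chi$) be Lipschitz continuous functions on $Y$, $f_x$ uniformly bounded. Let $Y_{sub}\subset Y^\circ$ be compact, of positive Lebesgue measure, such that the minimizer $x^*(y)=\arg\min_{x\in\chi}f_x(y)$ is unique for each $y\in Y_{sub}$. Consider the optimization problem $$\max_{a}\ H'_{Y_{sub}}(a)\quad\text{s.t.}\quad\sum_{x\in\chi}\int_{Y_{sub}}a(x,y)\,dy=1,$$ where $a$ ranges over non-negative (measurable) functions and $$H'_{Y_{sub}}(a)=\inf_{y\in Y_{sub}}\ C^{\frac1{1+\xi}}\min_{x\in\chi}\Big\{\zeta_x(y)\big(-W_{-1}(-e^{-\zeta_x(y)-1})\big)^{-\frac1{1+\xi}}[a(x,y)]^{\frac1{1+\xi}}\Big\}.$$ Then the following is an optimal solution: $$a^*(x,y)=\frac{\lambda\,\big(-W_{-1}(-e^{-\zeta_x(y)-1})\big)}{C\,[\zeta_x(y)]^{1+\xi}}\quad\forall x\in\chi,\ y\in Y_{sub},$$ where $$\lambda=\left(\sum_{x\in\chi}\int_{Y_{sub}}\frac{-W_{-1}(-e^{-\zeta_x(y)-1})}{C[\zeta_x(y)]^{1+\xi}}\,dy\right)^{-1}.$$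
   Context: $\chi$ is a finite set with at least two elements; $Y\subset\mathbb{R}^d$ is bounded with interior $Y^\circ$. For $y\in Y$ with unique minimizer $x^*=x^*(y)$, $$\zeta_x(y)=\begin{cases}\dfrac{(f_x(y)-f_{x^*}(y))^2}{4\sigma_x^2(y)},& x\ne x^*(y),\\[2mm] \dfrac{(\min_{x'\ne x^*(y)}f_{x'}(y)-f_{x^*}(y))^2}{4\sigma_{x^*}^2(y)},& x=x^*(y).\end{cases}$$ $\xi>0$ and $c>0$ are fixed constants, $C=\frac{\pi^{d/2}}{\Gamma(d/2+1)}c^d$ with $\Gamma$ Euler's gamma function. $W_{-1}$ is the lower branch of the Lambert $W$ function: for $z\in[-e^{-1},0)$, $W_{-1}(z)$ is the $w\le-1$ with $we^w=z$. *)

(* Defs.v *)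
From HB Require Import structures.
From mathcomp Require Import all_boot all_order all_algebra.
From mathcomp Require Import all_classical all_reals all_analysis.

Set Implicit Arguments.
Unset Strict Implicit.
Unset Printing Implicit Defensive.

Import Order.TTheory GRing.Theory Num.Theory.
Import numFieldNormedType.Exports.

Local Open Scope classical_set_scope.
Local Open Scope ring_scope.

Section lebesgue_Rn.
Context {R : realType} {d : nat}.
Local Notation Rd := 'rV[R]_d.

(* A box is given by its two corners; it is empty, with volume 0, as soon as
   p.2 < p.1 in one coordinate. *)
Definition box (p : Rd * Rd) : set Rd :=
  [set y | forall i, p.1 ord0 i <= y ord0 i <= p.2 ord0 i].

Definition box_volume (p : Rd * Rd) : R :=
  \prod_(i < d) Num.max 0 (p.2 ord0 i - p.1 ord0 i).

Lemma box_volume_ge0 p : 0 <= box_volume p.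
Proof. by apply: prodr_ge0 => i _; rewrite le_max lexx. Qed.

Definition box_cover (A : set Rd) : set (set (Rd * Rd)) :=
  [set S | countable S /\ A `<=` \bigcup_(p in S) box p].

Definition lebesgue_outer (A : set Rd) : \bar R :=
  ereal_inf [set (\esum_(p in S) (box_volume p)%:E)%E | S in box_cover A].

Local Open Scope ereal_scope.

Let vol (p : Rd * Rd) : \bar R := (box_volume p)%:E.

Let vol_ge0 p : 0 <= vol p.
Proof. by rewrite lee_fin box_volume_ge0. Qed.

Lemma lebesgue_outer_ge0 A : 0 <= lebesgue_outer A.
Proof. by apply: le_ereal_inf_tmp => _ [S _ <-]; apply: esum_ge0 => p _; exact: vol_ge0. Qed.

Lemma lebesgue_outer0 : lebesgue_outer set0 = 0.
Proof.
apply/eqP; rewrite eq_le lebesgue_outer_ge0 andbT.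
apply: ereal_inf_lbound; exists set0; last by rewrite esum_set0.
by split.
Qed.

Lemma le_lebesgue_outer : {homo lebesgue_outer : A B / A `<=` B >-> A <= B}.
Proof.
move=> A B AB; apply/ereal_inf_le_tmp => _ [S [cS BS] <-].
by exists S => //; split => //; exact: subset_trans BS.
Qed.

Let esum_bigcup_le (S : (set (Rd * Rd))^nat) :
  \esum_(p in \bigcup_n S n) vol p <= \sum_(n <oo) \esum_(p in S n) vol p.
Proof.
rewrite seqDU_bigcup_eq esum_bigcupT; last 2 first.
- exact: trivIset_seqDU.
- by move=> p; exact: vol_ge0.
rewrite nneseries_esumT; last by move=> n; apply: esum_ge0 => p _; exact: vol_ge0.
apply: le_esum => n _; apply: le_ereal_sup => _ [F [fF FS] <-].
exists F => //; split => //; apply: subset_trans FS _.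
exact: subset_seqDU.
Qed.

Lemma lebesgue_outer_sigma_subadditive : sigma_subadditive lebesgue_outer.
Proof.
move=> A; have [[i ioo]|] := pselect (exists i, lebesgue_outer (A i) = +oo).
  rewrite (eseries_pinfty _ _ ioo) ?leey// => n _.
  by rewrite -ltNye (lt_le_trans _ (lebesgue_outer_ge0 _)).
rewrite -forallNE => Aoo.
apply/lee_addgt0Pr => _/posnumP[e].
rewrite (le_trans _ (epsilon_trick _ _ _))//; last first.
  by move=> n; exact: lebesgue_outer_ge0.
pose P n (S : set (Rd * Rd)) := box_cover (A n) S /\
  \esum_(p in S) vol p <= lebesgue_outer (A n) + (e%:num / (2 ^ n.+1)%:R)%:E.
have [S PS] : {S : (set (Rd * Rd))^nat & forall n, P n (S n)}.
  apply: (@choice _ _ P) => n.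
  have en : (0 < e%:num / (2 ^ n.+1)%:R)%R by [].
  have fA : lebesgue_outer (A n) \is a fin_num.
    by rewrite ge0_fin_numE ?lebesgue_outer_ge0// ltey; exact/eqP/Aoo.
  have /(lb_ereal_inf_adherent en)[_ [S cS <-] lS] := fA.
  by exists S; split => //; exact: ltW.
apply: (@le_trans _ _ (\esum_(p in \bigcup_n S n) vol p)).
  apply: ereal_inf_lbound; exists (\bigcup_n S n) => //; split.
    by apply: bigcup_countable => // n _; have [[]] := PS n.
  move=> y [n _ Any]; have [[_ /(_ y Any)[p Sp py]] _] := PS n.
  by exists p => //; exists n.
apply: (le_trans (esum_bigcup_le S)); apply: lee_nneseries => n _.
- by move=> *; apply: esum_ge0 => p _; exact: vol_ge0.
- exact: (PS n).2.
Qed.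

HB.instance Definition _ := isOuterMeasure.Build R Rd lebesgue_outer
  lebesgue_outer0 lebesgue_outer_ge0 le_lebesgue_outer
  lebesgue_outer_sigma_subadditive.

End lebesgue_Rn.
Arguments lebesgue_outer R d : clear implicits.

(* R^d with the sigma-algebra of its Lebesgue measurable sets. *)
Definition lebRn (R : realType) (d : nat) : measurableType _ :=
  caratheodory_type (lebesgue_outer R d).

Section lebesgue_measure_Rn.
Context (R : realType) (d : nat).

Definition lebesgue_Rn : set (lebRn R d) -> \bar R := lebesgue_outer R d.

Let lebesgue_Rn0 : lebesgue_Rn set0 = 0%E.
Proof. exact: lebesgue_outer0. Qed.

Let lebesgue_Rn_ge0 A : (0 <= lebesgue_Rn A)%E.
Proof. exact: lebesgue_outer_ge0. Qed.

Let lebesgue_Rn_sigma_additive : semi_sigma_additive lebesgue_Rn.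
Proof. exact: caratheodory_measure_sigma_additive. Qed.

HB.instance Definition _ := isMeasure.Build _ _ _ lebesgue_Rn
  lebesgue_Rn0 lebesgue_Rn_ge0 lebesgue_Rn_sigma_additive.

End lebesgue_measure_Rn.
Arguments lebesgue_Rn R d : clear implicits.

Section special_functions.
Context {R : realType}.

Definition Gamma (s : R) : R :=
  \int[lebesgue_measure]_(t in `]0, +oo[) (t `^ (s - 1) * expR (- t)).

(* Lower branch of the Lambert W function; the default 0 is only returned
   outside [-1/e, 0), where no such w exists. *)
Definition lambertWm1 (z : R) : R :=
  xget 0 [set w | w <= -1 /\ w * expR w = z].

End special_functions.

(* Minimum of F over the i satisfying P, for P satisfiable. *)
Definition min_over (R : realType) (I : finType) (P : pred I) (F : I -> R) : R :=
  fine (\big[Order.min/+oo%E]_(i | P i) (F i)%:E).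

Definition minimizer (R : realType) (chi : finType) (T : Type)
    (f : chi -> T -> R) (y : T) : set chi :=
  [set x | forall x', f x y <= f x' y].

Section allocation.
Context {R : realType} {d : nat} {chi : finType}.
Local Notation Rd := 'rV[R]_d.
(* xstar is meant to select, at each point of Ysub, the unique minimizer of f;
   f, sigma and the allocations a are total functions, of which only the values
   on Ysub are used here. *)
Variables (f sigma : chi -> Rd -> R) (xstar : Rd -> chi).
Variables (xi c : R) (Ysub : set Rd).

Definition zeta (x : chi) (y : Rd) : R :=
  if x == xstar y then
    (min_over (predC1 (xstar y)) (f ^~ y) - f (xstar y) y) ^+ 2
      / (4 * sigma (xstar y) y ^+ 2)
  else (f x y - f (xstar y) y) ^+ 2 / (4 * sigma x y ^+ 2).

(* Volume of the Euclidean ball of radius c in R^d, written in closed form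
   because the norm of 'rV[R]_d is the sup norm. *)
Definition ball_constant : R :=
  pi `^ (d%:R / 2) / Gamma (d%:R / 2 + 1) * c ^+ d.

Definition negW (x : chi) (y : Rd) : R :=
  - lambertWm1 (- expR (- zeta x y - 1)).

Definition objective (a : chi -> Rd -> R) : \bar R :=
  ereal_inf [set (ball_constant `^ (1 + xi)^-1 *
      min_over xpredT (fun x => zeta x y * negW x y `^ (- (1 + xi)^-1)
                                * a x y `^ (1 + xi)^-1))%:E | y in Ysub].

Definition feasible (a : chi -> Rd -> R) : Prop :=
  [/\ forall x y, Ysub y -> 0 <= a x y,
      forall x, measurable_fun (Ysub : set (lebRn R d)) (a x) &
      (\sum_(x : chi) \int[lebesgue_Rn R d]_(y in Ysub) (a x y)%:E = 1)%E].

Definition optimal (a : chi -> Rd -> R) : Prop :=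
  feasible a /\ forall b, feasible b -> (objective b <= objective a)%E.

Definition lambda : R :=
  (\sum_(x : chi) \int[lebesgue_Rn R d]_(y in Ysub)
     (negW x y / (ball_constant * zeta x y `^ (1 + xi))))^-1.

Definition astar (x : chi) (y : Rd) : R :=
  lambda * negW x y / (ball_constant * zeta x y `^ (1 + xi)).

End allocation.

(* Main.v *)
(* At every y and x, zeta * w^(-1/p) * a^(1/p), with w = -W_{-1}(-e^(-zeta-1))
   and p = 1 + xi, takes the same value (r/C)^(1/p) at a = r * w / (C zeta^p);
   so a feasible b with a larger objective than astar dominates r * astar / lambda
   everywhere for some r > lambda, and has total mass r / lambda > 1.
   What has to be checked is that lambda is a positive real.  The function zeta x
   is continuous and positive on the compact set Ysub, since it is the squared gap
   between f x and the minimum of the other f x', and w, which solves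
   w - ln w = zeta + 1, is nondecreasing in zeta with 1 <= w <= 2 (zeta + 1).
   Continuity on a compact set yields Lebesgue measurability because half-spaces
   split boxes, hence are Caratheodory measurable, and a compact set is a
   countable intersection of finite unions of cubes. *)

Require Import Defs.
From HB Require Import structures.
From mathcomp Require Import all_boot all_order all_algebra.
From mathcomp Require Import finmap measurable_realfun.
From mathcomp Require Import all_classical all_reals all_analysis.
From mathcomp Require Import ring lra.
Import Order.TTheory GRing.Theory Num.Theory.
Import numFieldNormedType.Exports.
Local Open Scope classical_set_scope.
Local Open Scope ring_scope.

Set Implicit Arguments.
Unset Strict Implicit.
Unset Printing Implicit Defensive.

(** * Unordered sums over images *)

Lemma esum_subset {R : realType} {T : choiceType} (A B : set T)
    (a : T -> \bar R) :
  A `<=` B -> (\esum_(i in A) a i <= \esum_(i in B) a i)%E.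
Proof.
move=> AB; apply: le_ereal_sup => _ [F [fF FA] <-].
by exists F => //; split => //; exact: subset_trans AB.
Qed.

(** A section [h] of [e] on the image turns the left side into a sum over a subset of [P]. The
    non-injective case matters: cutting can send different boxes to the same one. *)
Lemma esum_image_le {R : realType} {T T' : choiceType} (P : set T)
    (e : T -> T') (a : T' -> \bar R) :
  (\esum_(j in e @` P) a j <= \esum_(i in P) a (e i))%E.
Proof.
(* Outside the image the section needs the default value [x0]. *)
have [P0|/set0P[x0 Px0]] := eqVneq P set0.
  by rewrite P0 image_set0 !esum_set0.
have [h hP] : {h : T' -> T & forall q, (e @` P) q -> P (h q) /\ e (h q) = q}.
  apply: (@choice _ _ (fun q x => (e @` P) q -> P x /\ e x = q)) => q.
  have [[x Px exq]|nq] := pselect ((e @` P) q); first by exists x.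
  by exists x0.
have -> : (\esum_(j in e @` P) a j = \esum_(j in e @` P) (a \o e) (h j))%E.
  by apply: eq_esum => q /hP[_ /= ->].
rewrite -(@esum_image _ _ _ _ h (a \o e)).
  by apply: esum_subset => _ [q /hP[? _] <-].
by move=> p q /[!inE] /hP[_ hp] /hP[_ hq] hpq; rewrite -hp hpq hq.
Qed.

(** * Lebesgue measurability of compact sets and continuous functions *)

Section lebesgue_Rn_borel.
Context {R : realType} {d : nat}.
Local Notation Rd := 'rV[R]_d.

(** Indexing the modified boxes by the original cover [S] lets the volumes of two modifications be
    added box by box. *)
Lemma lebesgue_outer_le_esum (S : set (Rd * Rd)) (g : Rd * Rd -> Rd * Rd)
    (A : set Rd) : countable S -> A `<=` \bigcup_(p in S) box (g p) ->
  (lebesgue_outer R d A <= \esum_(p in S) (box_volume (g p))%:E)%E.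
Proof.
move=> cS AS; apply: (le_trans _ (@esum_image_le _ _ _ S g (fun p => (box_volume p)%:E))).
apply: ereal_inf_lbound; exists (g @` S) => //; split.
  exact: (sub_countable (card_image_le g S)).
by move=> y /AS[p Sp py]; exists (g p).
Qed.

(** Both pieces are closed and may overlap in the hyperplane [y_i = t]; a piece that misses the box
    gets crossed corners, hence volume 0. *)
Definition box_below (i : 'I_d) (t : R) (p : Rd * Rd) : Rd * Rd :=
  (p.1, \row_j if j == i then Num.min (p.2 ord0 j) t else p.2 ord0 j).

Definition box_above (i : 'I_d) (t : R) (p : Rd * Rd) : Rd * Rd :=
  (\row_j if j == i then Num.max (p.1 ord0 j) t else p.1 ord0 j, p.2).

Lemma length_split (a b t : R) :
  Num.max 0 (Num.min b t - a) + Num.max 0 (b - Num.max a t) = Num.max 0 (b - a).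
Proof.
case: (leP b t) => bt; case: (leP a t) => ta.
- by rewrite [Num.max 0 (b - t)]max_l ?addr0//; lra.
- by rewrite max_l ?addr0//; lra.
- by rewrite !max_r; lra.
- by rewrite [Num.max 0 (t - a)]max_l ?add0r//; lra.
Qed.

Lemma box_volume_split i t p :
  box_volume (box_below i t p) + box_volume (box_above i t p) = box_volume p.
Proof.
rewrite /box_volume [in RHS](bigD1 i)//= (bigD1 i)//= [X in _ + X](bigD1 i)//=.
rewrite !mxE eqxx.
under eq_bigr => j /negPf ji do rewrite mxE ji.
under [X in _ + _ * X = _]eq_bigr => j /negPf ji do rewrite mxE ji.
rewrite -mulrDl; congr (_ * _).
set a := p.1 ord0 i; set b := p.2 ord0 i.
exact: length_split.
Qed.

(** Cutting each box of a cover of the test set [X] gives covers of the two parts of [X] with the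
    same total volume. *)
Lemma measurable_halfspace (i : 'I_d) (t : R) :
  measurable ([set y | y ord0 i <= t] : set (lebRn R d)).
Proof.
apply: le_caratheodory_measurable => X.
apply: le_ereal_inf_tmp => _ [S [cS XS] <-].
rewrite (_ : esum _ _ = \esum_(p in S) ((box_volume (box_below i t p))%:E +
    (box_volume (box_above i t p))%:E))%E; last first.
  by apply: eq_esum => p _; rewrite -EFinD box_volume_split.
rewrite esumD//; [|by move=> *; rewrite lee_fin box_volume_ge0..].
apply: leeD; apply: lebesgue_outer_le_esum => // y [/XS[p Sp py] /= yt];
  exists p => // j /=; rewrite mxE; case: eqP => [->|_]; have := py i;
  have := py j => //.
- by move=> _ /andP[-> /=]; rewrite le_min => ->.
- move=> _ /andP[+ ->]; rewrite andbT ge_max => ->.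
  by move: yt => /negP; rewrite -ltNge => /ltW.
Qed.

Lemma measurable_box p : measurable (box p : set (lebRn R d)).
Proof.
rewrite (_ : box p = \bigcap_(i in [set: 'I_d])
    ([set y | y ord0 i <= p.2 ord0 i] `&` [set y | p.1 ord0 i <= y ord0 i])).
  apply: fin_bigcap_measurable => // i _.
  apply: measurableI; first exact: measurable_halfspace.
  (* The reverse half-space is closed, so it is an intersection of complements of half-spaces with
     thresholds increasing to [p.1 ord0 i]. *)
  rewrite (_ : [set _ | _] = \bigcap_n
      ~` [set y | y ord0 i <= p.1 ord0 i - n.+1%:R^-1]).
    by apply: bigcap_measurable => // n _; apply: measurableC;
      exact: measurable_halfspace.
  apply/seteqP; split => y /=.
    move=> py n _ /=; apply/negP; rewrite -ltNge (lt_le_trans _ py)//.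
    by rewrite ltrBlDr ltrDl invr_gt0.
  move=> h; apply/ler_addgt0Pr => e e0.
  have [n ne] : exists n, n.+1%:R^-1 < e.
    by have [n _ /(_ n (leqnn n))] := near_infty_natSinv_lt (PosNum e0); exists n.
  have /negP := h n I; rewrite -ltNge => hy; rewrite -lerBlDr.
  by apply: ltW; apply: le_lt_trans hy; rewrite lerD2l lerN2 ltW.
apply/seteqP; split => [y py i _|y py i].
  by have /andP[] := py i.
by have [/= -> ->] := py i I.
Qed.

Definition cube (x : Rd) (r : R) : Rd * Rd :=
  (\row_j (x ord0 j - r), \row_j (x ord0 j + r)).

Lemma boxP_cube (x y : Rd) r :
  box (cube x r) y <-> forall i, `|x ord0 i - y ord0 i| <= r.
Proof.
by split=> h i; have := h i; rewrite /= ?mxE ler_norml -/(_ <= _); lra.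
Qed.

(** Balls of the sup norm lie in cubes, so for each [n] finitely many cubes of radius [1/(n+1)]
    centred in [K] cover [K]. A point in all these unions is a limit of centres, hence in [K]. *)
Lemma measurable_compact (K : set Rd) :
  compact K -> measurable (K : set (lebRn R d)).
Proof.
move=> cK.
have covK n : exists D : {fset Rd}, [set` D] `<=` K /\
    K `<=` \bigcup_(x in [set` D]) box (cube x n.+1%:R^-1).
  have := cK; rewrite compact_cover.
  move=> /(_ _ K (fun x => ball x n.+1%:R^-1)%R)[].
  - by move=> x _; exact: ball_open.
  - by move=> x Kx; exists x => //; exact: ballxx.
  - move=> D DK KD; exists D; split; first by move=> x /DK /set_mem.
    move=> y /KD[x Dx [_ xy]]; exists x => //; apply/boxP_cube => i.
    exact/ltW/xy.
have [D DK] := choice covK.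
rewrite (_ : K = \bigcap_n \bigcup_(x in [set` D n]) box (cube x n.+1%:R^-1)).
  apply: bigcapT_measurable => n; apply: fin_bigcup_measurable => // x _.
  exact: measurable_box.
apply/seteqP; split => [y Ky n _|y h]; first exact: (DK n).2.
apply: (compact_closed (@norm_hausdorff _ _) cK) => B /nbhs_ballP[e /= e0 eB].
have [n ne] : exists n, n.+1%:R^-1 < e.
  by have [n _ /(_ n (leqnn n))] := near_infty_natSinv_lt (PosNum e0); exists n.
have [x Dx /boxP_cube xy] := h n I.
exists x; split; first exact: (DK n).1.
apply: eB; split => // i j; rewrite ord1 /ball /= distrC.
exact: le_lt_trans ne.
Qed.

Lemma lebesgue_Rn_compact_lty (K : set Rd) :
  compact K -> (lebesgue_Rn R d K < +oo)%E.
Proof.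
move=> /compact_bounded /ex_strict_bound_gt0[M M0 /= KM].
apply: (@le_lt_trans _ _ (lebesgue_outer R d (box (cube 0 M)))).
  apply: le_lebesgue_outer => y Ky; apply/boxP_cube => i.
  rewrite mxE sub0r normrN.
  apply: le_trans (ltW (KM _ Ky)).
  rewrite [leRHS]/Num.Def.normr /= mx_normrE; apply/bigmax_geP; right => /=.
  by exists (ord0, i).
apply: le_lt_trans (ltry (box_volume (cube 0 M))).
rewrite -(@esum_set1 _ _ (cube 0 M) (fun p => (box_volume p)%:E)) ?lee_fin ?box_volume_ge0//.
apply: ereal_inf_lbound; exists [set cube 0 M] => //; split => //.
by move=> y By; exists (cube 0 M).
Qed.

(** The generators [[r, +oo[] are closed, so their preimages in [K] are compact. *)
Lemma measurable_fun_continuous_compact (K : set Rd) (g : Rd -> R) :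
  compact K -> {within K, continuous g} ->
  measurable_fun (K : set (lebRn R d)) g.
Proof.
move=> cK cg; have mK := measurable_compact cK.
apply: (measurability (@RGenCInfty.G R)) => [|/= _ [_] [r] -> <-].
  exact: RGenCInfty.measurableE.
have clK := compact_closed (@norm_hausdorff _ _) cK.
apply/measurable_compact/(subclosed_compact _ cK) => //.
rewrite setIC closed_setIS//; move/continuous_closedP: cg; apply.
rewrite (_ : [set` _] = [set x | r <= x]); first exact: closed_ge.
by apply/seteqP; split => x /=; rewrite in_itv/= andbT.
Qed.

End lebesgue_Rn_borel.

(** * Continuity of Lipschitz functions and of finite minima *)

Lemma lipschitz_within_continuous {R : realType} {V W : normedModType R}
    (A : set V) (f : V -> W) :
  [lipschitz f x | x in A] -> {within A, continuous f}.
Proof.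
move=> /pinfty_ex_gt0[M /= M0 fM].
apply/subspace_continuousP => x Ax; apply/cvgrPdist_le => e e0.
rewrite near_withinE; near=> y => Ay.
apply: le_trans (fM (x, y) _) _ => //=.
rewrite -ler_pdivlMl// mulrC.
near: y; apply: cvgr_dist_le; [exact: cvg_id|exact: divr_gt0].
Unshelve. all: by end_near. Qed.

Section min_over.
Context {R : realType} {I : finType}.

Lemma min_over_attained (P : pred I) (F : I -> R) i0 : P i0 ->
  exists2 i, P i & min_over P F = F i.
Proof.
move=> Pi0; rewrite /min_over.
have [|i Pi ->] := @eq_bigmin _ _ _ +oo%E i0 P (EFin \o F) Pi0.
  by move=> i _; rewrite leey.
by exists i.
Qed.

Lemma min_over_le (P : pred I) (F : I -> R) i : P i -> min_over P F <= F i.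
Proof.
move=> Pi; rewrite /min_over.
have [|j Pj e] := @eq_bigmin _ _ _ +oo%E i P (EFin \o F) Pi.
  by move=> ? _; rewrite leey.
rewrite [X in fine X]e /= -lee_fin -[leLHS]e.
exact: (bigmin_le_cond +oo%E (EFin \o F) Pi).
Qed.

(** Starting the fold at [F i0] instead of [+oo] keeps it in the reals, so that continuity follows
    by induction on the index list. *)
Lemma min_over_bigmin (P : pred I) (F : I -> R) i0 : P i0 ->
  min_over P F = \big[Order.min/F i0]_(i | P i) F i.
Proof.
move=> Pi0; apply/le_anti/andP; split.
  apply: le_bigmin => [|i Pi]; exact: min_over_le.
have [i Pi ->] := min_over_attained F Pi0; exact: bigmin_le_cond.
Qed.

Lemma min_over_continuous {T : topologicalType} (A : set T) (P : pred I)
    (F : I -> T -> R) i0 : P i0 ->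
  (forall i, {within A, continuous (F i)}) ->
  {within A, continuous (fun y => min_over P (F ^~ y))}.
Proof.
move=> Pi0 cF; under eq_fun => y do rewrite (min_over_bigmin _ Pi0).
elim: (index_enum I) => [|i r IH].
  by under eq_fun => y do rewrite big_nil; exact: cF.
under eq_fun => y do rewrite big_cons.
case: (P i) => //.
by move=> y; apply: continuous_min; [exact: cF|exact: IH].
Qed.

End min_over.

(** * The lower branch of the Lambert function, and the Gamma integral *)

Section lambert.
Context {R : realType}.
Implicit Types z w : R.

(** This is [negW] as a function of the value of [zeta] alone. *)
Definition lambert_rate z : R := - lambertWm1 (- expR (- z - 1)).

Lemma ln_le_subr1 w : 0 < w -> ln w <= w - 1.
Proof.
move=> w0; have -> : ln w = ln (1 + (w - 1)) by congr ln; lra.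
by apply: le_ln1Dx; lra.
Qed.

Lemma lambert_rate_subproof z : 0 <= z ->
  exists w, [/\ 1 <= w, w <= 2 * (z + 1) & w - ln w = z + 1].
Proof.
move=> z0.
have cf : {within `[1, 2 * (z + 1)], continuous (fun w => w - ln w)}.
  apply: continuous_in_subspaceT => w /[!inE] /=; rewrite in_itv/= => /andP[w1 _].
  apply: cvgB; first exact: cvg_id.
  by apply: continuous_ln; lra.
(* This makes [2 * (z + 1)] a valid right end for the intermediate value theorem. With
   [a = (z + 1) / 2], [exp (2a) >= (1 + a)^2 >= 4a]. *)
have ln2 : ln (2 * (z + 1)) <= z + 1.
  rewrite -[leRHS]expRK ler_ln ?posrE ?expR_gt0//; last lra.
  rewrite [in leRHS](_ : z + 1 = (z + 1) / 2 + (z + 1) / 2) ?expRD; last lra.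
  have := expR_ge1Dx ((z + 1) / 2).
  set E := expR _; set a := (z + 1) / 2; move=> aE.
  have a0 : 0 <= a by rewrite /a; lra.
  have : (1 + a) * (1 + a) <= E * E by apply: ler_pM; lra.
  have : 0 <= (1 - a) * (1 - a) by rewrite -expr2 sqr_ge0.
  by rewrite (_ : 2 * (z + 1) = 4 * a) /a; [lra|field].
have [||w] := @IVT R _ 1 (2 * (z + 1)) (z + 1) _ cf; first lra.
  by rewrite ln1 subr0 ge_min le_max; apply/andP; split; apply/orP; [left; lra|right; lra].
by rewrite in_itv/= => /andP[w1 w2] wE; exists w.
Qed.

Lemma lambert_rateP z : 0 <= z ->
  1 <= lambert_rate z /\ lambert_rate z - ln (lambert_rate z) = z + 1.
Proof.
move=> z0; pose S := [set w : R | w <= -1 /\ w * expR w = - expR (- z - 1)].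
have [w [w1 _ wE]] := lambert_rate_subproof z0.
have Sw : S (- w).
  rewrite /S /= lerN2; split => //.
  have w0 : 0 < w by lra.
  by rewrite mulNr -{1}(lnK w0) -expRD; congr (- expR _); lra.
(* [lambertWm1] is an [xget] on [S], so the equation is shown for every member of [S]; [- w] shows
   that [S] is inhabited. *)
suff SW (u : R) : S u -> 1 <= - u /\ - u - ln (- u) = z + 1.
  by apply: SW; exact: (xgetPex 0 (ex_intro S _ Sw)).
move=> [u1 uE].
have u0 : 0 < - u by lra.
split; first lra.
have : - u = expR (- u - z - 1).
  transitivity (- (u * expR u) * expR (- u)).
    by rewrite mulNr -mulrA -expRD subrr expR0 mulr1.
  by rewrite uE opprK -expRD; congr expR; lra.
move=> /(congr1 (@ln R)); rewrite expRK => ->; lra.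
Qed.

Lemma lambert_rate_ge1 z : 0 <= z -> 1 <= lambert_rate z.
Proof. by move=> /lambert_rateP[]. Qed.

(** Since [ln (w / 2) <= w / 2 - 1] and [ln 2 <= 1], [ln w <= w / 2], hence
    [z + 1 = w - ln w >= w / 2]. *)
Lemma lambert_rate_le z : 0 <= z -> lambert_rate z <= 2 * (z + 1).
Proof.
move=> /lambert_rateP[]; set w := lambert_rate z => w1 wE.
have : ln (w / 2) <= w / 2 - 1 by apply: ln_le_subr1; lra.
rewrite ln_div ?posrE; [|lra..].
have : ln 2 <= 2 - 1 :> R by apply: ln_le_subr1.
lra.
Qed.

(** If [1 <= v < w], then [ln w - ln v <= w / v - 1 <= w - v], so [v - ln v <= w - ln w],
    contradicting [z < z']. *)
Lemma lambert_rate_homo z z' : 0 <= z -> z <= z' ->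
  lambert_rate z <= lambert_rate z'.
Proof.
move=> z0; rewrite le_eqVlt => /predU1P[->//|zz'].
have [w1 wE] := lambert_rateP z0.
have [|v1 vE] := @lambert_rateP z'; first lra.
rewrite leNgt; apply/negP => vw.
set w := lambert_rate z in w1 wE vw; set v := lambert_rate z' in v1 vE vw.
have v0 : 0 < v by lra.
have : ln (w / v) <= w / v - 1 by apply: ln_le_subr1; apply: divr_gt0; lra.
rewrite ln_div ?posrE; [|lra..].
have : w / v - 1 <= w - v.
  by rewrite -[X in _ - X](@divff _ v) ?gt_eqF// -mulrBl ler_pdivrMr//; nra.
lra.
Qed.

(** Clamping at 0 makes the function monotone on the whole line. *)
Lemma measurable_lambert_rate :
  measurable_fun [set: R] (fun z => lambert_rate (Num.max 0 z)).
Proof.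
apply: nondecreasing_measurable => // z z' zz'.
apply: lambert_rate_homo; first by rewrite le_max lexx.
by rewrite ge_max !le_max lexx zz' orbT.
Qed.

End lambert.

(* The integral converges since ln (t / (2p)) <= t / (2p) - 1 gives
   t^p e^(-t) <= K e^(-t/2). *)
Lemma Gamma_gt0 {R : realType} (s : R) : 1 < s -> 0 < Gamma s.
Proof.
move=> s1; pose p := s - 1; have p0 : 0 < p by rewrite /p; lra.
pose F t := t `^ p * expR (- t).
have mF : measurable_fun [set: R] F.
  apply: measurable_funM; first exact: measurable_powR.
  by apply: measurableT_comp => //; exact: measurable_funN.
have F0 t : 0 <= F t by rewrite mulr_ge0 ?powR_ge0 ?expR_ge0.
pose K := expR (p * ln (2 * p) - p).
(* The factor 2 cancels the rate [1/2] in the exponential density, whose total mass 1 then bounds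
   the integral. *)
have FK (t : R) : 0 < t -> F t <= 2 * K * exponential_pdf 2^-1 t.
  move=> t0; rewrite exponential_pdfE ?(ltW t0)//.
  rewrite [leRHS](_ : _ = K * expR (- 2^-1 * t)); last by field.
  rewrite /F -[t in t `^ p](lnK t0) -expRM -!expRD ler_expR.
  have : ln (t / (2 * p)) <= t / (2 * p) - 1.
    by apply: ln_le_subr1; apply: divr_gt0; lra.
  rewrite ln_div ?posrE//; last lra.
  rewrite -(ler_pM2l p0).
  have -> : p * (t / (2 * p) - 1) = t / 2 - p by field; lra.
  lra.
rewrite /Gamma /Rintegral fine_gt0//; apply/andP; split.
  (* On [[1, 2]] the integrand is at least [exp (-2)], because [t^p >= 1] there. *)
  apply: (@lt_le_trans _ _ (expR (- 2))%:E); first by rewrite lte_fin expR_gt0.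

  apply: (@le_trans _ _ (\int[lebesgue_measure]_(t in `[1%R, 2%R]%classic) (F t)%:E)%E).
    rewrite -[leLHS]mule1 -[X in (_ * X)%E](_ : lebesgue_measure `[1 : R, 2]%classic = 1%E).
      rewrite -integral_cst//; apply: ge0_le_integral => //.
      - by move=> t _; rewrite lee_fin expR_ge0.
      - by apply/measurable_EFinP; exact: measurable_funTS.
      move=> t /=; rewrite in_itv/= => /andP[t1 t2]; rewrite lee_fin.
      rewrite -[leLHS]mul1r; apply: ler_pM => //; rewrite ?expR_ge0//.
        by rewrite -(powRr0 t) ler_powR// ltW.
      by rewrite ler_expR lerN2.
    rewrite lebesgue_measure_itv/= lte_fin ifT; last by rewrite ltrDl.
    by rewrite -EFinB; congr EFin; lra.
  apply: ge0_subset_integral => //.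
  - by apply/measurable_EFinP; exact: measurable_funTS.
  - by move=> t _; rewrite lee_fin F0.
  - by move=> t /=; rewrite !in_itv/= andbT => /andP[t1 _]; exact: lt_le_trans t1.
apply: (@le_lt_trans _ _ (\int[lebesgue_measure]_(t in `]0%R, +oo[%classic)
    ((2 * K)%:E * (exponential_pdf 2^-1 t)%:E))%E).
  apply: ge0_le_integral => //.
  - by move=> t _; rewrite lee_fin F0.
  - by apply/measurable_EFinP; exact: measurable_funTS.
  - apply/measurable_EFinP; apply: measurable_funM => //.
    by apply: measurable_funTS; exact: measurable_exponential_pdf.
  - by move=> t /=; rewrite in_itv/= andbT => /FK; rewrite -EFinM lee_fin.
have K0 : 0 <= 2 * K by rewrite mulr_ge0// expR_ge0.
have mpdf : measurable_fun setT (fun t : R => (exponential_pdf 2^-1 t)%:E).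
  by apply/measurable_EFinP; exact: measurable_exponential_pdf.
have pdf0 (t : R) : (0 <= (exponential_pdf 2^-1 t)%:E)%E.
  by rewrite lee_fin exponential_pdf_ge0.
rewrite ge0_integralZl//; last exact: measurable_funTS.
apply: lte_mul_pinfty => //.
apply: (@le_lt_trans _ _ (\int[lebesgue_measure]_t (exponential_pdf (2^-1 : R) t)%:E)%E).
  exact: ge0_subset_integral.
by rewrite integral_exponential_pdf ?ltry.
Qed.

(** * Positivity of [zeta] at points with a unique minimizer *)

Section zeta.
Context {R : realType} {d : nat} {chi : finType}.
Local Notation Rd := 'rV[R]_d.
Variables (f sigma : chi -> Rd -> R) (xstar : Rd -> chi).
Hypothesis hchi : (1 < #|chi|)%N.

(** Under uniqueness this is negative at the minimizer and positive elsewhere; [zeta] depends only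
    on its square. *)
Definition gap x y := f x y - min_over (predC1 x) (f ^~ y).

Lemma exists_other (x : chi) : exists x', predC1 x x'.
Proof.
have /card_gt1P[u [v [_ _ uv]]] := hchi.
have [ux|ux] := eqVneq u x; last by exists u; exact: ux.
by exists v; rewrite /= -ux eq_sym.
Qed.

(* For x <> xstar y the minimum over x' <> x is f (xstar y) y, so that both
   cases in the definition of zeta measure the same gap. *)
Lemma zetaE x y : unique (minimizer f y) (xstar y) ->
  zeta f sigma xstar x y = gap x y ^+ 2 / (4 * sigma x y ^+ 2).
Proof.
move=> [ymin _]; rewrite /zeta /gap; have [->|xx] := eqVneq x (xstar y).
  by rewrite -sqrrN opprB.
congr ((_ - _) ^+ 2 / _); apply/le_anti/andP; split.
  have [x' x'x] := exists_other x.
  by have [i _ ->] := min_over_attained (f ^~ y) x'x; exact: ymin.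
by apply: min_over_le; rewrite /= eq_sym.
Qed.

(** A zero gap at the minimizer would give a second minimizer; a zero gap elsewhere would make [x]
    itself a minimizer. *)
Lemma gap_neq0 x y : unique (minimizer f y) (xstar y) -> gap x y != 0.
Proof.
move=> [ymin yuniq]; apply/eqP => /subr0_eq.
have [x' x'x] := exists_other x.
have [i ix iE] := min_over_attained (f ^~ y) x'x; rewrite iE => fxi.
have [xE|xx] := eqVneq x (xstar y).
  have /yuniq xsi : minimizer f y i by move=> j; rewrite -fxi xE; exact: ymin.
  by move: ix; rewrite /= xE xsi eqxx.
have /eqP[] := xx; apply/esym/yuniq => j; apply: le_trans (ymin j).
by rewrite fxi -iE; apply: min_over_le; rewrite /= eq_sym.
Qed.

End zeta.

(** * Bounds and measurability for the density *)

Section integral_bounds.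
Context {dsp : measure_display} {T : measurableType dsp} {R : realType}.
Variables (mu : {measure set T -> \bar R}) (D : set T).

Lemma integral_bounded_gt0_lty (g : T -> R) (m M : R) :
  measurable D -> (0 < mu D < +oo)%E -> measurable_fun D g -> 0 < m ->
  (forall y, D y -> m <= g y <= M) ->
  (0 < \int[mu]_(y in D) (g y)%:E < +oo)%E.
Proof.
move=> mD /andP[D0 Doo] mg m0 gmM.
have g0 y : D y -> (0 <= (g y)%:E)%E.
  by move=> /gmM /andP[mgy _]; rewrite lee_fin (le_trans (ltW m0)).
have mg' : measurable_fun D (EFin \o g) by exact/measurable_EFinP.
apply/andP; split.
  apply: (@lt_le_trans _ _ (m%:E * mu D)%E); first by rewrite mule_gt0.
  rewrite -integral_cst//; apply: ge0_le_integral => //.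
  - by move=> y _; rewrite lee_fin ltW.
  - by move=> y /gmM /andP[mgy _]; rewrite lee_fin.
have [D00|/set0P[y0 Dy0]] := eqVneq D set0.
  by rewrite D00 integral_set0.
have M0 : 0 <= M.
  by have /andP[a b] := gmM _ Dy0; apply: le_trans b; apply: le_trans a; exact: ltW.
apply: (@le_lt_trans _ _ (M%:E * mu D)%E); last exact: lte_mul_pinfty.
rewrite -integral_cst//; apply: ge0_le_integral => //.
by move=> y /gmM /andP[_ gyM]; rewrite lee_fin.
Qed.

End integral_bounds.

Lemma powR_invK {R : realType} (p a : R) : 0 < p -> 0 <= a ->
  (a `^ p) `^ p^-1 = a.
Proof. by move=> p0 a0; rewrite -powRrM divff ?gt_eqF// powRr1. Qed.

(** The factor [(w / z^p)^(1/p) = w^(1/p) / z] cancels the weight [z * w^(-1/p)]. *)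
Lemma rate_density {R : realType} (p B z w r : R) :
  0 < p -> 0 < B -> 0 < z -> 0 < w -> 0 <= r ->
  z * w `^ (- p^-1) * (r * w / (B * z `^ p)) `^ p^-1 = (r / B) `^ p^-1.
Proof.
move=> p0 B0 z0 w0 r0.
have -> : r * w / (B * z `^ p) = (r / B) * (w * (z `^ p)^-1).
  by rewrite invfM mulrACA [_ * (w / _)]mulrC mulrA.
have zp0 : 0 < z `^ p by exact: powR_gt0.
have rB0 : 0 <= r / B by rewrite divr_ge0// ltW.
have wz0 : 0 <= (z `^ p)^-1 by rewrite invr_ge0 ltW.
rewrite (powRM _ rB0) ?mulr_ge0 ?(ltW w0)// (powRM _ (ltW w0) wz0).
have -> : (z `^ p)^-1 `^ p^-1 = z^-1.
  by rewrite -powR_inv1 ?(ltW zp0)// powRAC powR_invK ?(ltW z0)// powR_inv1// ltW.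
rewrite powRN; field.
by rewrite !gt_eqF ?powR_gt0.
Qed.

(** This is [astar] without the factor [lambda]; [B] stands for the ball constant and [z] for the
    value of [zeta]. *)
Definition density {R : realType} (p B z : R) : R :=
  lambert_rate z / (B * z `^ p).

Section density.
Context {R : realType} (p B : R).
Hypotheses (p0 : 0 < p) (B0 : 0 < B).

(** The numerator lies between 1 and [2 * (z + 1)], and the denominator increases with [z]. *)
Lemma density_bounds (a b z : R) : 0 < a -> a <= z <= b ->
  (B * b `^ p)^-1 <= density p B z <= 2 * (b + 1) / (B * a `^ p).
Proof.
move=> a0 /andP[az zb].
have z0 : 0 < z by exact: lt_le_trans az.
have b0 : 0 < b by exact: lt_le_trans zb.
have den0 t : 0 < t -> 0 < B * t `^ p by move=> t0; rewrite mulr_gt0// powR_gt0.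
have denle t u : 0 < t -> t <= u -> (B * u `^ p)^-1 <= (B * t `^ p)^-1.
  move=> t0 tu; have u0 : 0 < u by exact: lt_le_trans tu.
  rewrite lef_pV2 ?posrE ?den0// ler_pM2l//.
  by apply: ge0_ler_powR; rewrite ?nnegrE// ltW.
have z0' := ltW z0.
apply/andP; split.
  rewrite -[leLHS]mul1r; apply: ler_pM; rewrite ?denle//.
    by rewrite invr_ge0 ltW ?den0.
  exact: lambert_rate_ge1.
apply: ler_pM; rewrite ?denle//.
- by apply: le_trans (lambert_rate_ge1 z0').
- by rewrite invr_ge0 ltW ?den0.
- by apply: le_trans (lambert_rate_le z0') _; lra.
Qed.

Lemma measurable_density {dsp} {T : measurableType dsp} (D : set T)
    (g : T -> R) : (forall y, D y -> 0 < g y) -> measurable_fun D g ->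
  measurable_fun D (fun y => density p B (g y)).
Proof.
move=> g0 mg.
(* [h] is measurable on the whole line and agrees with the density at positive arguments. *)
pose h z := B^-1 * (lambert_rate (Num.max 0 z) * z `^ (- p)).
apply: (@eq_measurable_fun _ _ _ _ _ (h \o g)).
  move=> y /[!inE] /g0 gy.
  rewrite /h /density /= max_r ?(ltW gy)// powRN invfM; ring.
apply: measurableT_comp => //.
apply: measurable_funM => //.
by apply: measurable_funM; [exact: measurable_lambert_rate|exact: measurable_powR].
Qed.

End density.

(** * Positivity of the ball constant and continuity of [zeta] *)

Lemma ball_constant_gt0 {R : realType} (d : nat) (c : R) :
  (0 < d)%N -> 0 < c -> 0 < @ball_constant R d c.
Proof.
move=> d0 c0; rewrite /ball_constant mulr_gt0 ?exprn_gt0// divr_gt0//.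
  by rewrite powR_gt0// pi_gt0.
by apply: Gamma_gt0; rewrite ltrDr divr_gt0// ltr0n.
Qed.

Lemma zeta_continuous {R : realType} (d : nat) (chi : finType)
    (f sigma : chi -> 'rV[R]_d -> R) (xstar : 'rV[R]_d -> chi)
    (A : set 'rV[R]_d) (x : chi) :
  (1 < #|chi|)%N ->
  (forall x, {within A, continuous (f x)}) ->
  (forall x, {within A, continuous (sigma x)}) ->
  (forall x y, A y -> 0 < sigma x y) ->
  (forall y, A y -> unique (minimizer f y) (xstar y)) ->
  {within A, continuous (zeta f sigma xstar x)}.
Proof.
move=> hchi cf cs s0 hx.
(* The gap formula removes the case distinction on [xstar y], which could jump with [y]. *)
apply: (@subspace_eq_continuous _ _ _
    (fun y => gap f x y ^+ 2 / (4 * sigma x y ^+ 2))).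
  move=> y Ay; apply: (esym (zetaE sigma hchi x _)).
  by apply: hx; rewrite inE in Ay.
have [x' x'x] := exists_other hchi x.
have cgap : {within A, continuous (gap f x)}.
  by move=> y; apply: cvgB; [exact: cf|exact: (min_over_continuous x'x cf)].
rewrite continuous_subspace_in => y /[!inE] Ay.
apply: cvgM; first by apply: cvgM; exact: cgap.
apply: cvgV; first by rewrite mulf_neq0// expf_neq0// gt_eqF// s0.
by apply: cvgM; [exact: cvg_cst|apply: cvgM; exact: cs].
Qed.

(** * Optimality of the equalizing allocation *)

Theorem theorem4 (R : realType) (d : nat) (hd : (0 < d)%N)
    (chi : finType) (hchi : (1 < #|chi|)%N)
    (Y : set 'rV[R]_d) (hY : bounded_set Y)
    (f sigma : chi -> 'rV[R]_d -> R)
    (hf : forall x : chi, [lipschitz f x y | y in Y])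
    (hsigma : forall x : chi, [lipschitz sigma x y | y in Y])
    (hsigma0 : forall (x : chi) (y : 'rV[R]_d), Y y -> 0 < sigma x y)
    (hfb : exists M : R, forall (x : chi) (y : 'rV[R]_d), Y y -> `|f x y| <= M)
    (xi c : R) (hxi : 0 < xi) (hc : 0 < c)
    (Ysub : set 'rV[R]_d) (hYsub : Ysub `<=` interior Y)
    (hcompact : compact Ysub) (hpos : (0 < lebesgue_Rn R d Ysub)%E)
    (xstar : 'rV[R]_d -> chi)
    (hxstar : forall y : 'rV[R]_d, Ysub y ->
      unique (minimizer f y) (xstar y)) :
  optimal f sigma xstar xi c Ysub (astar f sigma xstar xi c Ysub).
Proof.
pose p := 1 + xi; have p0 : 0 < p by rewrite /p; lra.
pose B := @ball_constant R d c; have B0 : 0 < B by exact: ball_constant_gt0.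
pose Z := zeta f sigma xstar.
pose G x y := density p B (Z x y).
pose L := lambda f sigma xstar xi c Ysub.
have astarE x y : astar f sigma xstar xi c Ysub x y = L * G x y.
  by rewrite /astar -mulrA.
have YsubY : Ysub `<=` Y by move=> y /hYsub; exact: interior_subset.
have s0 x y : Ysub y -> 0 < sigma x y by move=> /YsubY; exact: hsigma0.
have cZ x : {within Ysub, continuous (Z x)}.
  apply: zeta_continuous => // x'; apply: (continuous_subspaceW YsubY);
  exact: lipschitz_within_continuous.
have Z0 x y : Ysub y -> 0 < Z x y.
  move=> Yy; have hy := hxstar y Yy.
  rewrite /Z zetaE//; apply: divr_gt0.
    by rewrite exprn_even_gt0//= (gap_neq0 hchi x hy).
  by rewrite mulr_gt0// exprn_gt0// s0.
have [y0 Yy0] : Ysub !=set0.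
  by apply/set0P/eqP => Y0; move: hpos; rewrite Y0 measure0 ltxx.
pose mu := lebesgue_Rn R d.
have mY : measurable (Ysub : set (lebRn R d)) by exact: measurable_compact.
have mG x : measurable_fun (Ysub : set (lebRn R d)) (G x).
  apply: measurable_density => [y|]; first exact: Z0.
  exact: measurable_fun_continuous_compact.
have G0 x y : Ysub y -> 0 < G x y.
  move=> Yy; have z0 := Z0 x y Yy.
  apply: divr_gt0; last by rewrite mulr_gt0 ?powR_gt0.
  by apply: lt_le_trans (lambert_rate_ge1 (ltW z0)).
have IG x : (0 < \int[mu]_(y in Ysub) (G x y)%:E < +oo)%E.
  (* The extreme values of [Z x] on [Ysub] bound [G x] between positive constants. *)
  have [|a aY aZ] := compact_EVT_min _ hcompact (cZ x); first by exists y0.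
  have [|b bY bZ] := compact_EVT_max _ hcompact (cZ x); first by exists y0.
  rewrite !inE in aY bY.
  apply: (@integral_bounded_gt0_lty _ _ _ mu _ _ (B * Z x b `^ p)^-1
    (2 * (Z x b + 1) / (B * Z x a `^ p))) => //.
  - by rewrite hpos lebesgue_Rn_compact_lty.
  - by rewrite invr_gt0 mulr_gt0// powR_gt0// Z0.
  - move=> y Yy; apply: density_bounds => //; first exact: Z0.
    by rewrite aZ ?bZ// inE.
pose I := \sum_(x : chi) \int[mu]_(y in Ysub) G x y.
(* [lambda] uses real integrals and [feasible] extended ones; finiteness identifies them. *)
have IE : (\sum_(x : chi) \int[mu]_(y in Ysub) (G x y)%:E = I%:E)%E.
  rewrite -sumEFin; apply: eq_bigr => x _.
  have /andP[I0 Ioo] := IG x.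
  by rewrite /Rintegral fineK// ge0_fin_numE// ltW.
have I0 : 0 < I.
  have rI0 x : 0 < \int[mu]_(y in Ysub) G x y by apply: fine_gt0; exact: IG.
  by rewrite /I (bigD1 (xstar y0))//= ltr_wpDr// sumr_ge0// => x _; exact: ltW.
(* [negW] unfolds to [lambert_rate] of [zeta], so this holds by conversion. *)
have LI : L = I^-1 by [].
have L0 : 0 < L by rewrite LI invr_gt0.
have intr r : 0 <= r ->
    (\sum_(x : chi) \int[mu]_(y in Ysub) (r * G x y)%:E = (r * I)%:E)%E.
  move=> r0; rewrite EFinM -IE ge0_sume_distrr; last first.
    by move=> x _; have /andP[/ltW] := IG x.
  apply: eq_bigr => x _; rewrite -ge0_integralZl_EFin//.
  - by move=> y Yy; rewrite lee_fin ltW// G0.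
  - exact/measurable_EFinP.
pose term (a : chi -> 'rV[R]_d -> R) y x :=
  Z x y * lambert_rate (Z x y) `^ (- p^-1) * a x y `^ p^-1.
have termE r a x y : 0 <= r -> Ysub y -> a x y = r * G x y ->
    B `^ p^-1 * term a y x = r `^ p^-1.
  move=> r0 Yy axy; rewrite /term axy /G /density [r * (_ / _)]mulrA.
  rewrite rate_density//; last 2 first.
  - exact: Z0.
  - by apply: lt_le_trans (lambert_rate_ge1 (ltW (Z0 x y Yy))).
  rewrite -powRM ?divr_ge0 ?(ltW B0)// mulrC divfK ?gt_eqF//.
have Bp0 : 0 < B `^ p^-1 by rewrite powR_gt0.
have obj_star : objective f sigma xstar xi c Ysub
    (astar f sigma xstar xi c Ysub) = (L `^ p^-1)%:E.
  rewrite /objective (_ : [set _ | _ in _] = [set (L `^ p^-1)%:E]) ?ereal_inf1//.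
  have valE y : Ysub y -> B `^ p^-1 *
      min_over xpredT (term (astar f sigma xstar xi c Ysub) y) = L `^ p^-1.
    move=> Yy.
    have [x _ ->] := min_over_attained
      (term (astar f sigma xstar xi c Ysub) y) (isT : xpredT (xstar y0)).
    by apply: termE => //; exact: ltW.
  apply/seteqP; split => [_ [y Yy <-]|_ ->] /=.
    by congr EFin; exact: valE.
  by exists y0 => //; congr EFin; exact: valE.
split.
  split => [x y Yy|x|].
  - by rewrite astarE mulr_ge0// ltW// G0.
  - rewrite (_ : astar _ _ _ _ _ _ x = fun y => L * G x y).
      by apply: measurable_funM.
    by apply/funext => y; exact: astarE.
  - under eq_bigr => x _.
      under eq_integral => y _ do rewrite astarE.
      over.
    by rewrite intr ?(ltW L0)// LI mulVf// gt_eqF.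
move=> b [b0 mb intb]; rewrite obj_star leNgt; apply/negP => Lb.
have obj_le y : Ysub y -> (objective f sigma xstar xi c Ysub b <=
    (B `^ p^-1 * min_over xpredT (term b y))%:E)%E.
  by move=> Yy; apply: ereal_inf_lbound; exists y.
(* The value is above a real by [Lb] and below the real value at [y0]. *)
have [v vE] : exists v, objective f sigma xstar xi c Ysub b = v%:E.
  move: Lb (obj_le _ Yy0).
  by case: (objective _ _ _ _ _ _ b) => // v _ _; exists v.
move: Lb; rewrite vE lte_fin => Lv.
have v0 : 0 <= v by apply: le_trans (ltW Lv); exact: powR_ge0.
(* With this [r], every term of the allocation [r * G], scaled by [B^(1/p)], equals [v]. *)
pose r := v `^ p; have r0 : 0 <= r by exact: powR_ge0.
have vr : v = r `^ p^-1 by rewrite powR_invK.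
have Lr : L < r.
  have LpK : (L `^ p^-1) `^ p = L by rewrite -powRrM mulVf ?gt_eqF// powRr1// ltW.
  by rewrite -LpK; apply: gt0_ltr_powR; rewrite ?nnegrE ?powR_ge0.
(* If [b x y < r * G x y], the term at [x] would push the minimum at [y] below [v], the infimum. *)
have rb x y : Ysub y -> r * G x y <= b x y.
  move=> Yy; have := obj_le y Yy; rewrite vE lee_fin vr.
  rewrite leNgt => /negP h; rewrite leNgt; apply/negP => bG; apply: h.
  rewrite -(@termE r (fun x y => r * G x y) x y)// ltr_pM2l//.
  apply: (le_lt_trans (@min_over_le _ _ xpredT (term b y) x isT)).
  rewrite /term ltr_pM2l; last first.
    rewrite mulr_gt0 ?Z0// powR_gt0//.
    by apply: lt_le_trans (lambert_rate_ge1 (ltW (Z0 x y Yy))).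
  by apply: gt0_ltr_powR; rewrite ?invr_gt0 ?nnegrE ?b0// mulr_ge0// ltW// G0.
(* Integrating [rb] gives [r * I <= 1], whereas [r > L = 1 / I]. *)
have : ((r * I)%:E <= 1)%E.
  rewrite -intr// -intb; apply: lee_sum => x _; apply: ge0_le_integral => //.
  - by move=> y Yy; rewrite lee_fin mulr_ge0// ltW// G0.
  - by apply/measurable_EFinP/measurable_funM.
  - exact/measurable_EFinP.
  - by move=> y Yy; rewrite lee_fin rb.
rewrite lee_fin; apply/negP; rewrite -ltNge.
by rewrite -(@mulVf _ I) ?gt_eqF// -LI ltr_pM2r.
Qed.
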